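(* Let $\Gamma_2=PU(2,1;\mathcal{O}_2)$ with $\mathcal{O}_2=\mathbb{Z}[i\sqrt{2}]$, and let $(\Gamma_2)_\infty$ be the stabiliser of $q_\infty$ in $\Gamma_2$. Then $(\Gamma_2)_\infty$ is generated by $$R_1=\begin{bmatrix}1&0&0\\0&-1&0\\0&0&1\end{bmatrix},\quad R_2=\begin{bmatrix}1&2&-2\\0&-1&2\\0&0&1\end{bmatrix},\quad R_3=\begin{bmatrix}1&-i\sqrt{2}&-1\\0&-1&i\sqrt{2}\\0&0&1\end{bmatrix}\quad\text{and}\quad T=\begin{bmatrix}1&0&i\sqrt{2}\\0&1&0\\0&0&1\end{bmatrix}.$$ A presentation is given by $$(\Gamma_2)_\infty=\langle R_1,R_2,R_3,T\mid R_j^2=[T,R_j]=(T^2R_1R_3R_2)^2=\mathrm{id}\ \ (j=1,2,3)\rangle.$$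
   Context: $\mathbb{C}^{2,1}$ is $\mathbb{C}^3$ with the Hermitian form $\langle \mathbf{z},\mathbf{w}\rangle=z_1\bar{w}_3+z_2\bar{w}_2+z_3\bar{w}_1$. $U(2,1)$ is the group of $3\times 3$ complex matrices preserving this form, and $PU(2,1)=U(2,1)/U(1)$, where $U(1)=\{e^{i\theta}I\}$. $PU(2,1;\mathcal{O})$ denotes the subgroup of $PU(2,1)$ consisting of classes of matrices in $U(2,1)$ with all entries in the ring $\mathcal{O}$; matrices stand for their classes. $q_\infty$ is the point of the complex projective plane represented by the column vector $[1,0,0]^t$. $[a,b]$ denotes the commutator $aba^{-1}b^{-1}$. *)

(* Defs.v *)
From HB Require Import structures.
From mathcomp Require Import all_boot all_order all_algebra.
From mathcomp Require Import all_classical all_reals all_analysis.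
From mathcomp.real_closed Require Import complex.
From mathcomp Require Import ring.

Set Implicit Arguments.
Unset Strict Implicit.
Unset Printing Implicit Defensive.
Import Order.TTheory GRing.Theory Num.Theory.

Local Open Scope classical_set_scope.
Local Open Scope group_scope.

Section Subgroups.
Variable G : groupType.
Implicit Types (S H : set G) (a b : G).

Definition comm a b : G := a * b * a^-1 * b^-1.

Definition is_subgroup H :=
  [/\ H 1, (forall a b, H a -> H b -> H (a * b)) & (forall a, H a -> H a^-1)].

Definition is_normal_subgroup H :=
  is_subgroup H /\ (forall a b, H a -> H (b * a * b^-1)).

Definition generated S : set G := smallest is_subgroup S.

Definition normal_closure S : set G := smallest is_normal_subgroup S.

End Subgroups.

(* The letter (x, true) stands for x and the letter (x, false) for x^-1. *)
Inductive free_eq (X : Type) : seq (X * bool) -> seq (X * bool) -> Prop :=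
| free_eq_refl u : free_eq u u
| free_eq_sym u v : free_eq u v -> free_eq v u
| free_eq_trans u v w : free_eq u v -> free_eq v w -> free_eq u w
| free_eq_cancel u v x e :
    free_eq (u ++ (x, e) :: (x, ~~ e) :: v) (u ++ v).

Section FreeGroup.
Variable X : choiceType.
Local Notation word := (seq (X * bool)).
Implicit Types (u v w : word) (x : X).
Local Open Scope quotient_scope.

Definition free_rel : rel word := fun u v => `[< free_eq u v >].

Lemma free_rel_refl : reflexive free_rel.
Proof. by move=> u; apply/asboolP; exact: free_eq_refl. Qed.

Lemma free_rel_sym : symmetric free_rel.
Proof.
by move=> u v; apply/idP/idP => /asboolP uv; apply/asboolP; exact: free_eq_sym.
Qed.

Lemma free_rel_trans : transitive free_rel.
Proof.
move=> v u w /asboolP uv /asboolP vw; apply/asboolP.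
exact: free_eq_trans uv vw.
Qed.

Canonical free_equiv :=
  EquivRel free_rel free_rel_refl free_rel_sym free_rel_trans.

Definition free_group := {eq_quot free_equiv}.
HB.instance Definition _ := Choice.on free_group.
HB.instance Definition _ := EqQuotient.on free_group.

Lemma free_piP u v : \pi_free_group u = \pi_free_group v <-> free_eq u v.
Proof.
by split => [/eqmodP/asboolP|uv]; [|apply/eqmodP/asboolP].
Qed.

Lemma free_eq_cat u u' v v' :
  free_eq u u' -> free_eq v v' -> free_eq (u ++ v) (u' ++ v').
Proof.
have catl a b c : free_eq a b -> free_eq (c ++ a) (c ++ b).
  elim=> {a b} [a|a b _|a b d _ ab _ bd|a b x e].
  - exact: free_eq_refl.
  - exact: free_eq_sym.
  - exact: free_eq_trans ab bd.
  - by rewrite !catA; exact: free_eq_cancel.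
have catr a b c : free_eq a b -> free_eq (a ++ c) (b ++ c).
  elim=> {a b} [a|a b _|a b d _ ab _ bd|a b x e].
  - exact: free_eq_refl.
  - exact: free_eq_sym.
  - exact: free_eq_trans ab bd.
  - by rewrite -!catA; exact: free_eq_cancel.
move=> uu vv; apply: (free_eq_trans (v := u' ++ v)); first exact: catr.
exact: catl.
Qed.

Definition inv_word w : word := rev [seq (l.1, ~~ l.2) | l <- w].

Lemma inv_wordK : involutive inv_word.
Proof.
move=> w; rewrite /inv_word map_rev revK -map_comp -[RHS]map_id.
by apply: eq_map => -[x e] /=; rewrite negbK.
Qed.

Lemma free_eq_inv u v : free_eq u v -> free_eq (inv_word u) (inv_word v).
Proof.
elim=> {u v} [u|u v _|u v w _ uv _ vw|u v x e].
- exact: free_eq_refl.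
- exact: free_eq_sym.
- exact: free_eq_trans uv vw.
- rewrite /inv_word !map_cat /= !rev_cat !rev_cons -!cats1 -!catA /=.
  by rewrite -{2}(negbK e); exact: free_eq_cancel.
Qed.

Lemma free_eq_mulV w : free_eq (w ++ inv_word w) [::].
Proof.
elim: w => [|[x e] w IHw]; first exact: free_eq_refl.
rewrite /inv_word /= rev_cons -cats1 catA.
apply: (free_eq_trans (v := [:: (x, e)] ++ [:: (x, ~~ e)])).
  exact: (@free_eq_cat ((x, e) :: (w ++ inv_word w)) [:: (x, e)] _ _
            (free_eq_cat (free_eq_refl [:: (x, e)]) IHw) (free_eq_refl _)).
exact: (free_eq_cancel [::]).
Qed.

Lemma free_eq_mulVl w : free_eq (inv_word w ++ w) [::].
Proof. by rewrite -{2}[w]inv_wordK; exact: free_eq_mulV. Qed.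

Definition free_mul (f g : free_group) : free_group :=
  \pi_free_group (repr f ++ repr g).
Definition free_one : free_group := \pi_free_group [::].
Definition free_inv (f : free_group) : free_group :=
  \pi_free_group (inv_word (repr f)).

Lemma free_repr_pi u : free_eq (repr (\pi_free_group u)) u.
Proof. by apply/free_piP; rewrite reprK. Qed.

Lemma free_mulE u v :
  free_mul (\pi_free_group u) (\pi_free_group v) = \pi_free_group (u ++ v).
Proof. by apply/free_piP; apply: free_eq_cat; exact: free_repr_pi. Qed.

Lemma free_invE u :
  free_inv (\pi_free_group u) = \pi_free_group (inv_word u).
Proof. by apply/free_piP; apply: free_eq_inv; exact: free_repr_pi. Qed.

Fact free_mulA : associative free_mul.
Proof.
move=> f g h; elim/quotW: f => u; elim/quotW: g => v; elim/quotW: h => w.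
by rewrite (free_mulE v w) (free_mulE u (v ++ w)) (free_mulE u v)
  (free_mulE (u ++ v) w) catA.
Qed.

Fact free_mul1 : left_id free_one free_mul.
Proof. by move=> f; elim/quotW: f => u; rewrite free_mulE. Qed.

Fact free_mulr1 : right_id free_one free_mul.
Proof. by move=> f; elim/quotW: f => u; rewrite free_mulE cats0. Qed.

Fact free_mulV : left_inverse free_one free_inv free_mul.
Proof.
move=> f; elim/quotW: f => u; rewrite free_invE free_mulE; apply/free_piP.
exact: free_eq_mulVl.
Qed.

Fact free_mulrV : right_inverse free_one free_inv free_mul.
Proof.
move=> f; elim/quotW: f => u; rewrite free_invE free_mulE; apply/free_piP.
exact: free_eq_mulV.
Qed.

HB.instance Definition _ := isGroup.Build free_group
  free_mulA free_mul1 free_mulr1 free_mulV free_mulrV.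

Definition free_gen x : free_group := \pi_free_group [:: (x, true)].

Section Lift.
Variables (G : groupType) (g : X -> G).

Definition word_eval w : G :=
  \prod_(l <- w) (if l.2 then g l.1 else (g l.1)^-1).

(* The homomorphism from the free group that extends g. *)
Definition free_lift (f : free_group) : G := word_eval (repr f).

Lemma word_eval_cat u v : word_eval (u ++ v) = word_eval u * word_eval v.
Proof. by rewrite /word_eval big_cat. Qed.

Lemma word_eval_free_eq u v : free_eq u v -> word_eval u = word_eval v.
Proof.
elim=> {u v} [//|//|u v w _ -> _ -> //|u v x e].
rewrite !word_eval_cat; congr (_ * _).
rewrite /word_eval !big_cons mulgA; case: e => /=.
- by rewrite mulgV mul1g.
- by rewrite mulVg mul1g.
Qed.

Lemma free_lift_pi u : free_lift (\pi_free_group u) = word_eval u.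
Proof. by apply: word_eval_free_eq; exact: free_repr_pi. Qed.

Lemma free_liftM : {morph free_lift : f h / f * h}.
Proof.
move=> f h; elim/quotW: f => u; elim/quotW: h => v.
rewrite [_ * _]free_mulE !free_lift_pi.
exact: word_eval_cat.
Qed.

Lemma free_lift1 : free_lift 1 = 1.
Proof. by rewrite (free_lift_pi [::]) /word_eval big_nil. Qed.

HB.instance Definition _ :=
  isMultiplicative.Build free_group G free_lift free_liftM.
HB.instance Definition _ :=
  Multiplicative_isUMagmaMorphism.Build free_group G free_lift free_lift1.

Lemma free_lift_gen x : free_lift (free_gen x) = g x.
Proof. by rewrite free_lift_pi /word_eval big_seq1. Qed.

End Lift.
End FreeGroup.

(* The subgroup H of G has the presentation < X | rels >, the letter x being
   interpreted as g x. *)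
Definition has_presentation (G : groupType) (H : set G) (X : choiceType)
    (g : X -> G) (rels : set (free_group X)) :=
  range (free_lift g) = H /\
  [set f | free_lift g f = 1] = normal_closure rels.

Section UnitaryGroup.
Variable R : realType.
Local Notation C := R[i].
Local Open Scope ring_scope.
Local Open Scope quotient_scope.
Implicit Types (z w : 'cV[C]_3) (A B : 'M[C]_3).

Definition herm z w : C :=
  z 0 0 * (w 2 0)^* + z 1 0 * (w 1 0)^* + z 2 0 * (w 0 0)^*.

Definition preserves_form A : bool :=
  `[< forall z w, herm (A *m z) (A *m w) = herm z w >].

Record U21 := MkU21 { U21_mx :> 'M[C]_3; U21_mxP : preserves_form U21_mx }.

HB.instance Definition _ := [isSub for U21_mx].
HB.instance Definition _ := [Choice of U21 by <:].

Lemma preserves_formP A :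
  reflect (forall z w, herm (A *m z) (A *m w) = herm z w) (preserves_form A).
Proof. exact: asboolP. Qed.

Lemma ord3P (P : 'I_3 -> Prop) : P 0 -> P 1 -> P 2 -> forall i, P i.
Proof.
move=> P0 P1 P2 [[|[|[|//]]] lti].
- by rewrite (_ : Ordinal lti = 0) //; exact: val_inj.
- by rewrite (_ : Ordinal lti = 1) //; exact: val_inj.
- by rewrite (_ : Ordinal lti = 2) //; exact: val_inj.
Qed.

Lemma herm_nondegenerate z : (forall w, herm z w = 0) -> z = 0.
Proof.
move=> z0; apply/matrixP => i j; rewrite (ord1 j) mxE; move: i.
apply: ord3P.
- have := z0 (delta_mx 2 0).
  by rewrite /herm !mxE /= !rmorph0 rmorph1 !mulr0 mulr1 !addr0.
- have := z0 (delta_mx 1 0).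
  by rewrite /herm !mxE /= !rmorph0 rmorph1 !mulr0 mulr1 add0r addr0.
- have := z0 (delta_mx 0 0).
  by rewrite /herm !mxE /= !rmorph0 rmorph1 !mulr0 mulr1 !add0r.
Qed.

Lemma preserves_form_unit A : preserves_form A -> A \in unitmx.
Proof.
move=> /preserves_formP pA; rewrite -unitmx_tr -row_free_unit.
apply/inj_row_free => v vA0; apply: trmx_inj; rewrite trmx0.
apply: herm_nondegenerate => w.
rewrite -pA -[A in A *m v^T]trmxK -trmx_mul vA0 trmx0.
by rewrite /herm !mxE !mul0r !addr0.
Qed.

Fact preserves_form1 : preserves_form 1%:M.
Proof. by apply/preserves_formP => z w; rewrite !mul1mx. Qed.

Fact preserves_formM A B :
  preserves_form A -> preserves_form B -> preserves_form (A *m B).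
Proof.
move=> /preserves_formP pA /preserves_formP pB; apply/preserves_formP => z w.
by rewrite -!mulmxA pA pB.
Qed.

Fact preserves_formV A : preserves_form A -> preserves_form (invmx A).
Proof.
move=> pA; apply/preserves_formP => z w.
by rewrite -(preserves_formP _ pA) !mulKVmx ?preserves_form_unit.
Qed.

Definition U21_one := MkU21 preserves_form1.
Definition U21_mul (a b : U21) :=
  MkU21 (preserves_formM (U21_mxP a) (U21_mxP b)).
Definition U21_inv (a : U21) := MkU21 (preserves_formV (U21_mxP a)).

Fact U21_mulA : associative U21_mul.
Proof. by move=> a b c; apply: val_inj; rewrite /= mulmxA. Qed.
Fact U21_mul1 : left_id U21_one U21_mul.
Proof. by move=> a; apply: val_inj; rewrite /= mul1mx. Qed.
Fact U21_mulr1 : right_id U21_one U21_mul.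
Proof. by move=> a; apply: val_inj; rewrite /= mulmx1. Qed.
Fact U21_mulV : left_inverse U21_one U21_inv U21_mul.
Proof.
by move=> a; apply: val_inj; rewrite /= mulVmx ?preserves_form_unit ?U21_mxP.
Qed.
Fact U21_mulrV : right_inverse U21_one U21_inv U21_mul.
Proof.
by move=> a; apply: val_inj; rewrite /= mulmxV ?preserves_form_unit ?U21_mxP.
Qed.

HB.instance Definition _ := isGroup.Build U21
  U21_mulA U21_mul1 U21_mulr1 U21_mulV U21_mulrV.

Definition expi (theta : R) : C := (cos theta +i* sin theta)%C.

Lemma expiD a b : expi (a + b) = expi a * expi b.
Proof. by rewrite /expi cosD sinD; simpc; rewrite [X in (_ +i* X)%C]addrC. Qed.

Lemma expi0 : expi 0 = 1.
Proof. by rewrite /expi cos0 sin0. Qed.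

Definition U1 : set U21 := [set u | exists theta, U21_mx u = (expi theta)%:M].

Definition PU_rel : rel U21 := fun a b => `[< U1 (a^-1 * b)%g >].

Lemma PU_relP (a b : U21) :
  reflect (exists theta, U21_mx b = expi theta *: U21_mx a) (PU_rel a b).
Proof.
have ua := preserves_form_unit (U21_mxP a).
apply: (iffP (asboolP _)) => -[t] /= e; exists t.
  by rewrite -[LHS](mulKVmx ua) e mul_mx_scalar.
rewrite -[LHS]/(invmx a *m U21_mx b).
by rewrite e -scalemxAr mulVmx // scalemx1.
Qed.

Lemma PU_rel_refl : reflexive PU_rel.
Proof. by move=> a; apply/PU_relP; exists 0; rewrite expi0 scale1r. Qed.

Lemma PU_rel_sym : symmetric PU_rel.
Proof.
suff s a b : PU_rel a b -> PU_rel b a by move=> a b; apply/idP/idP; exact: s.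
case/PU_relP => t e; apply/PU_relP; exists (- t).
by rewrite e scalerA -expiD addNr expi0 scale1r.
Qed.

Lemma PU_rel_trans : transitive PU_rel.
Proof.
move=> b a c /PU_relP[t e] /PU_relP[s f]; apply/PU_relP; exists (s + t).
by rewrite f e scalerA expiD.
Qed.

Canonical PU_equiv := EquivRel PU_rel PU_rel_refl PU_rel_sym PU_rel_trans.

Definition PU21 := {eq_quot PU_equiv}.
HB.instance Definition _ := Choice.on PU21.
HB.instance Definition _ := EqQuotient.on PU21.

Lemma PU_piP (a b : U21) : \pi_PU21 a = \pi_PU21 b <->
  exists theta, U21_mx b = expi theta *: U21_mx a.
Proof. by split => [/eqmodP/PU_relP|/PU_relP/eqmodP]. Qed.

Definition PU_mul (g h : PU21) : PU21 := \pi_PU21 (repr g * repr h)%g.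
Definition PU_one : PU21 := \pi 1%g.
Definition PU_inv (g : PU21) : PU21 := \pi_PU21 (repr g)^-1%g.

Lemma PU_repr_pi (a : U21) :
  exists theta, U21_mx (repr (\pi_PU21 a)) = expi theta *: U21_mx a.
Proof. by apply/PU_piP; rewrite reprK. Qed.

Lemma PU_mulE (a b : U21) :
  PU_mul (\pi_PU21 a) (\pi_PU21 b) = \pi_PU21 (a * b)%g.
Proof.
apply/esym/PU_piP; have [s es] := PU_repr_pi a; have [t et] := PU_repr_pi b.
exists (s + t) => /=.
by rewrite es et -scalemxAl -scalemxAr scalerA expiD.
Qed.

Lemma PU_invE (a : U21) : PU_inv (\pi_PU21 a) = \pi_PU21 a^-1%g.
Proof.
apply/esym/PU_piP; have [s es] := PU_repr_pi a; exists (- s) => /=.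
have ua := preserves_form_unit (U21_mxP a).
have ur := preserves_form_unit (U21_mxP (repr (\pi_PU21 a))).
apply: (can_inj (mulKmx ur)); rewrite mulmxV // es -scalemxAl -scalemxAr.
by rewrite mulmxV // scalerA -expiD addrN expi0 scale1r.
Qed.

Fact PU_mulA : associative PU_mul.
Proof.
move=> f g h; elim/quotW: f => a; elim/quotW: g => b; elim/quotW: h => c.
by rewrite (PU_mulE b c) (PU_mulE a (b * c)%g) (PU_mulE a b)
  (PU_mulE (a * b)%g c) mulgA.
Qed.
Fact PU_mul1 : left_id PU_one PU_mul.
Proof. by move=> f; elim/quotW: f => a; rewrite PU_mulE mul1g. Qed.
Fact PU_mulr1 : right_id PU_one PU_mul.
Proof. by move=> f; elim/quotW: f => a; rewrite PU_mulE mulg1. Qed.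
Fact PU_mulV : left_inverse PU_one PU_inv PU_mul.
Proof. by move=> f; elim/quotW: f => a; rewrite PU_invE PU_mulE mulVg. Qed.
Fact PU_mulrV : right_inverse PU_one PU_inv PU_mul.
Proof. by move=> f; elim/quotW: f => a; rewrite PU_invE PU_mulE mulgV. Qed.

HB.instance Definition _ := isGroup.Build PU21
  PU_mulA PU_mul1 PU_mulr1 PU_mulV PU_mulrV.

Lemma PU_piM (a b : U21) : \pi_PU21 (a * b)%g = (\pi_PU21 a * \pi_PU21 b)%g.
Proof. by rewrite [RHS]PU_mulE. Qed.

Definition PU21_over (O : set C) : set PU21 :=
  [set g | exists2 a : U21, (forall i j, O (U21_mx a i j)) & g = \pi_PU21 a].

(* The points of the projective plane are the lines of C^3. *)
Record P2 := MkP2 { line :> {vspace 'cV[C]_3}; line_dim : \dim line == 1%N }.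

HB.instance Definition _ := [isSub for line].

Fact dim_U21_line (a : U21) (p : P2) : \dim (linfun (mulmx a) @: line p) == 1%N.
Proof.
rewrite limg_dim_eq ?line_dim //; apply/eqP; rewrite -subv0.
apply/subvP => v; rewrite memv_cap memv_ker lfunE /= => /andP[_ /eqP av0].
by rewrite -[v](mulKmx (preserves_form_unit (U21_mxP a))) av0 mulmx0 memv0.
Qed.

Definition U21_act (a : U21) (p : P2) : P2 := MkP2 (dim_U21_line a p).

Definition PU21_act (g : PU21) (p : P2) : P2 := U21_act (repr g) p.

Lemma PU21_act_pi (a : U21) (p : P2) : PU21_act (\pi_PU21 a) p = U21_act a p.
Proof.
apply: val_inj => /=; have [t ->] := PU_repr_pi a.
have t0 : expi t != 0.
  apply/eqP => t0; have := oner_neq0 C.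
  by rewrite -expi0 -(subrr t) expiD t0 mul0r eqxx.
apply/vspaceP => v; apply/memv_imgP/memv_imgP => -[u up ->].
  exists (expi t *: u); first exact: memvZ.
  by rewrite !lfunE /= -scalemxAl scalemxAr.
exists ((expi t)^-1 *: u); first exact: memvZ.
by rewrite !lfunE /= -scalemxAl -scalemxAr scalerA mulfV // scale1r.
Qed.

Definition stabiliser (H : set PU21) (p : P2) : set PU21 :=
  [set g | H g /\ PU21_act g p = p].

Fact dim_q_inf : \dim <[delta_mx 0 0 : 'cV[C]_3]> == 1%N.
Proof.
rewrite dim_vline eqb1.
by apply/eqP => /matrixP/(_ 0 0)/eqP; rewrite !mxE /= oner_eq0.
Qed.

Definition q_inf : P2 := MkP2 dim_q_inf.

(* The ring Z[alpha]. *)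
Definition Zadjoin (alpha : C) : set C :=
  [set z | exists p : {poly int}, z = (map_poly intr p).[alpha]].

Definition isqrt2 : C := (0 +i* Num.sqrt 2)%C.

Definition O2 : set C := Zadjoin isqrt2.

Definition Gamma2 : set PU21 := PU21_over O2.
Definition Gamma2_inf : set PU21 := stabiliser Gamma2 q_inf.

Definition mx3 (rows : seq (seq C)) : 'M[C]_3 :=
  \matrix_(i, j) nth 0 (nth [::] rows i) j.

Definition R1_mx := mx3 [:: [:: 1;  0; 0]
                          ; [:: 0; -1; 0]
                          ; [:: 0;  0; 1]].
Definition R2_mx := mx3 [:: [:: 1;  2; -2]
                          ; [:: 0; -1;  2]
                          ; [:: 0;  0;  1]].
Definition R3_mx := mx3 [:: [:: 1; - isqrt2;     -1]
                          ; [:: 0;       -1; isqrt2]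
                          ; [:: 0;        0;      1]].
Definition T_mx  := mx3 [:: [:: 1; 0; isqrt2]
                          ; [:: 0; 1;      0]
                          ; [:: 0; 0;      1]].

Lemma conj_isqrt2 : isqrt2^* = - isqrt2.
Proof. by rewrite /isqrt2; apply/eqP; rewrite eq_complex /= oppr0 !eqxx. Qed.

Lemma sqr_isqrt2 : isqrt2 * isqrt2 = - 2.
Proof.
rewrite /isqrt2; simpc; rewrite -expr2 sqr_sqrtr ?ler0n //.
by rewrite -opprD.
Qed.

Lemma mx3_mulE rows z (i : 'I_3) : (mx3 rows *m z) i 0 =
  nth 0 (nth [::] rows i) 0 * z 0 0 + nth 0 (nth [::] rows i) 1 * z 1 0
    + nth 0 (nth [::] rows i) 2 * z 2 0.
Proof.
rewrite mxE !big_ord_recl big_ord0 addr0 addrA !mxE /=.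
by congr (_ * z _ _ + _ * z _ _ + _ * z _ _); exact: val_inj.
Qed.

Fact R1_U21 : preserves_form R1_mx.
Proof.
apply/preserves_formP => z w; rewrite /herm !mx3_mulE /=.
by rewrite !(rmorphD, rmorphM, rmorphN, rmorph0, rmorph1) /=; ring.
Qed.

Fact R2_U21 : preserves_form R2_mx.
Proof.
apply/preserves_formP => z w; rewrite /herm !mx3_mulE /=.
by rewrite !(rmorphD, rmorphM, rmorphN, rmorph0, rmorph1, rmorph_nat) /=; ring.
Qed.

Fact R3_U21 : preserves_form R3_mx.
Proof.
apply/preserves_formP => z w; rewrite /herm !mx3_mulE /=.
rewrite !(rmorphD, rmorphM, rmorphN, rmorph0, rmorph1) /= conj_isqrt2.
by have := sqr_isqrt2; move: isqrt2 => s s2; ring: s2.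
Qed.

Fact T_U21 : preserves_form T_mx.
Proof.
apply/preserves_formP => z w; rewrite /herm !mx3_mulE /=.
rewrite !(rmorphD, rmorphM, rmorphN, rmorph0, rmorph1) /= conj_isqrt2.
by ring.
Qed.

Definition R1 : PU21 := \pi_PU21 (MkU21 R1_U21).
Definition R2 : PU21 := \pi_PU21 (MkU21 R2_U21).
Definition R3 : PU21 := \pi_PU21 (MkU21 R3_U21).
Definition T : PU21 := \pi_PU21 (MkU21 T_U21).

Definition Gamma2_inf_gen : 'I_4 -> PU21 := tnth [tuple R1; R2; R3; T].

End UnitaryGroup.

Arguments O2 R : clear implicits.
Arguments Gamma2 R : clear implicits.
Arguments Gamma2_inf R : clear implicits.

(* The letters 0, 1, 2, 3 of 'I_4 stand for R_1, R_2, R_3, T. *)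
Definition Gamma2_inf_rels : set (free_group 'I_4) :=
  let r1 := free_gen (0%R : 'I_4) in
  let r2 := free_gen (1%R : 'I_4) in
  let r3 := free_gen (2%R : 'I_4) in
  let t := free_gen (3%R : 'I_4) in
  [set r ^+ 2 | r in [set r1; r2; r3]]
  `|` [set comm t r | r in [set r1; r2; r3]]
  `|` [set (t ^+ 2 * r1 * r3 * r2) ^+ 2].

(* Main.v *)
Require Import Defs.
From HB Require Import structures.
From mathcomp Require Import all_boot all_order all_algebra.
From mathcomp Require Import all_classical all_reals all_analysis.
From mathcomp.real_closed Require Import complex.
From mathcomp Require Import ring zify.

(** A class of [Gamma2] that fixes [q_inf] is represented by an upper
    triangular matrix over Z[i sqrt 2].  Its diagonal entries are units of that
    ring, hence signs, and after division by the first one it has the form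

      [ 1  - d conj(e)  c ]
      [ 0       d       e ]      d = 1 or -1,   2 Re c = - |e|^2.
      [ 0       0       1 ]

    Writing e = p + n i sqrt 2, and as Re c is an integer, the last equation
    says that p ^ 2 + 2 n ^ 2 is even; so p = 2 m, and the matrix is
    [heis d m n k] with c = - (2 m ^ 2 + n ^ 2) + k i sqrt 2 (here d is a bit
    that encodes the sign).  Hence the stabiliser is the set of the quadruples
    (d, m, n, k) with an explicit product: a Heisenberg group over the integers,
    extended by a sign ([Gamma2_inf_heis], [heis_Gamma2_inf], [heisM]).

    On the side of the presentation, put a = r2 r1 and b = r3 r1.  The relators
    say that t is central, that r1 inverts a and b, and, for the last one, that
    b a = a b t ^ 4 ([mul_ba]).  These rules bring every product of generators
    to the shape a ^ m b ^ n t ^ k r1 ^ d ([normal_form_mul_closed]), in every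
    group in which the relators hold, in particular in the quotient of the free
    group by the normal closure of the relators.

    The matrix of a ^ m b ^ n t ^ k r1 ^ d is [heis d m n (k - 2 m n)]
    ([normal_form_heis]).  So the normal forms exhaust the stabiliser, which
    gives the generation; and only the trivial one has the trivial class
    ([pi_heis_eq1]), so that a word that is trivial in [PU21] has the trivial
    normal form and lies in the normal closure of the relators ([ker_lift]). *)

Set Implicit Arguments.
Unset Strict Implicit.
Unset Printing Implicit Defensive.
Import Order.TTheory GRing.Theory Num.Theory.

Local Open Scope classical_set_scope.
Local Open Scope group_scope.

(** * Integer powers in a group *)

Section IntegerPower.
Implicit Types G H : groupType.

Definition zpow G (x : G) (n : int) : G :=
  match n with Posz k => x ^+ k | Negz k => x ^- k.+1 end.

(** The equivalence in the step lets one induction run in both directions; it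
    comes for free below, where the step is cancellation of a factor. *)
Lemma int_iff_ind (P : int -> Prop) :
  P 0%R -> (forall n, P n <-> P (n + 1)%R) -> forall n, P n.
Proof.
move=> P0 PS; elim/int_rec => [//|n Pn|n Pn].
- by have := (PS (Posz n)).1 Pn; rewrite -addn1 PoszD.
- by apply/PS; rewrite (_ : (_ + 1)%R = (- Posz n)%R)//; lia.
Qed.

Lemma zpowS G (x : G) n : zpow x (n + 1)%R = x * zpow x n.
Proof.
case: n => [n|[|n]].
- by rewrite (_ : (_ + _)%R = Posz n.+1) /= ?expgS //; lia.
- by rewrite /= mulgV.
- rewrite (_ : (_ + _)%R = Negz n); last by lia.
  by rewrite /= (expgSr x n.+1) invgM mulVKg.
Qed.

(** The main tool for identities between integer powers: a family that obeys
    the recursion of the powers of x is the family of these powers. *)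
Lemma zpow_unique G (x : G) (f : int -> G) :
  f 0%R = 1 -> (forall n, f (n + 1)%R = x * f n) -> forall n, f n = zpow x n.
Proof.
move=> f0 fS; elim/int_iff_ind => [//|n]; rewrite fS zpowS.
by split => [->|/mulgI].
Qed.

Lemma zpowD G (x : G) m n : zpow x (m + n)%R = zpow x m * zpow x n.
Proof.
apply: (mulIg (zpow x n)^-1); rewrite mulgK; move: m.
apply: (zpow_unique (f := fun m => zpow x (m + n)%R * (zpow x n)^-1)).
  by rewrite add0r mulgV.
by move=> m; rewrite addrAC zpowS mulgA.
Qed.

Lemma zpowM G (x : G) m n : zpow x (m * n)%R = zpow (zpow x m) n.
Proof.
move: n; apply: (zpow_unique (f := fun n => zpow x (m * n)%R)).
  by rewrite mulr0.
by move=> n; rewrite mulrDr mulr1 addrC zpowD.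
Qed.

Lemma zpowVn G (x : G) n : zpow x^-1 n = zpow x (- n)%R.
Proof.
apply/esym; move: n; apply: (zpow_unique (f := fun n => zpow x (- n)%R)) => //.
move=> n; apply: (mulgI x); rewrite mulVKg -zpowS.
by congr zpow; ring.
Qed.

Lemma zpow_intertwine G (x x' y : G) n :
  y * x = x' * y -> y * zpow x n = zpow x' n * y.
Proof.
move=> yx; apply: (mulIg y^-1); rewrite mulgK; move: n.
apply: (zpow_unique (f := fun n => y * zpow x n * y^-1)).
  by rewrite mulg1 mulgV.
by move=> n; rewrite zpowS mulgA yx !mulgA.
Qed.

Lemma commute_zpow G (x y : G) n : commute x y -> commute x (zpow y n).
Proof. exact: zpow_intertwine. Qed.

Lemma zpowMn G (x y : G) n :
  commute x y -> zpow (x * y) n = zpow x n * zpow y n.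
Proof.
move=> xy; apply/esym; move: n.
apply: (zpow_unique (f := fun n => zpow x n * zpow y n)).
  by rewrite mulg1.
move=> n; rewrite !zpowS !mulgA; congr (_ * _); rewrite -!mulgA; congr (_ * _).
exact: commute_sym (commute_zpow _ (commute_sym xy)).
Qed.

(** Each of the m letters a that b passes leaves one central factor z behind. *)
Lemma zpow_shuffle G (a b z : G) m n :
  commute a z -> commute b z -> b * a = a * z * b ->
  b * (zpow a m * zpow b n) = zpow a m * zpow b (n + 1)%R * zpow z m.
Proof.
move=> az bz ba; rewrite mulgA (zpow_intertwine m ba) (zpowMn _ az) -!mulgA.
rewrite -zpowS; congr (_ * _).
exact: commute_zpow (commute_sym (commute_zpow m bz)).
Qed.

Lemma gmulf_zpow G H (f : UMagmaMorphism.type G H) (x : G) n :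
  f (zpow x n) = zpow (f x) n.
Proof. by case: n => n; rewrite /= (gmulfXn, gmulfXVn). Qed.

End IntegerPower.

(** * Quotient of a group by a normal subgroup *)

Section Quotient.
Local Open Scope quotient_scope.
Variables (G : groupType) (N : set G).
Hypothesis nN : is_normal_subgroup N.

Definition coset_rel : rel G := fun x y => `[< N (x^-1 * y) >].

Lemma coset_rel_refl : reflexive coset_rel.
Proof. by move=> x; apply/asboolP; rewrite mulVg; case: nN => -[]. Qed.

Lemma coset_rel_sym : symmetric coset_rel.
Proof.
have [[_ _ NV] _] := nN.
by move=> x y; apply/asboolP/asboolP => /NV; rewrite invgM invgK.
Qed.

Lemma coset_rel_trans : transitive coset_rel.
Proof.
have [[_ NM _] _] := nN.
move=> y x z /asboolP xy /asboolP yz; apply/asboolP.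
by have := NM _ _ xy yz; rewrite mulgA mulgK.
Qed.

Canonical coset_equiv :=
  EquivRel coset_rel coset_rel_refl coset_rel_sym coset_rel_trans.

Definition quotient_group := {eq_quot coset_equiv}.
HB.instance Definition _ := Choice.on quotient_group.
HB.instance Definition _ := EqQuotient.on quotient_group.

Lemma quotient_piP x y :
  \pi_quotient_group x = \pi_quotient_group y <-> N (x^-1 * y).
Proof. by split => [/eqmodP/asboolP|xy]; [|apply/eqmodP/asboolP]. Qed.

Definition quotient_mul (x y : quotient_group) : quotient_group :=
  \pi_quotient_group (repr x * repr y).
Definition quotient_one : quotient_group := \pi_quotient_group 1.
Definition quotient_inv (x : quotient_group) : quotient_group :=
  \pi_quotient_group (repr x)^-1.

Lemma quotient_mulE x y :
  quotient_mul (\pi_quotient_group x) (\pi_quotient_group y) =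
  \pi_quotient_group (x * y).
Proof.
have [[_ NM _] NJ] := nN.
set x' := repr (\pi_quotient_group x); set y' := repr (\pi_quotient_group y).
have xx : N (x'^-1 * x) by apply/quotient_piP; rewrite reprK.
have yy : N (y'^-1 * y) by apply/quotient_piP; rewrite reprK.
(* The quotient of the two products is a conjugate of xx followed by yy. *)
apply/quotient_piP; have := NM _ _ (NJ _ y'^-1 xx) yy.
by rewrite invgK invgM !mulgA mulgK.
Qed.

Lemma quotient_invE x :
  quotient_inv (\pi_quotient_group x) = \pi_quotient_group x^-1.
Proof.
have [[_ NM NV] NJ] := nN.
have xx : N ((repr (\pi_quotient_group x))^-1 * x).
  by apply/quotient_piP; rewrite reprK.
apply/quotient_piP; have := NJ _ x (NV _ xx).
by rewrite !invgM !invgK !mulgA mulgV mul1g.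
Qed.

Fact quotient_mulA : associative quotient_mul.
Proof.
move=> x y z; elim/quotW: x => x; elim/quotW: y => y; elim/quotW: z => z.
by rewrite (quotient_mulE y z) (quotient_mulE x (y * z)) (quotient_mulE x y)
  (quotient_mulE (x * y) z) mulgA.
Qed.
Fact quotient_mul1 : left_id quotient_one quotient_mul.
Proof. by move=> x; elim/quotW: x => x; rewrite quotient_mulE mul1g. Qed.
Fact quotient_mulr1 : right_id quotient_one quotient_mul.
Proof. by move=> x; elim/quotW: x => x; rewrite quotient_mulE mulg1. Qed.
Fact quotient_mulV : left_inverse quotient_one quotient_inv quotient_mul.
Proof.
by move=> x; elim/quotW: x => x; rewrite quotient_invE quotient_mulE mulVg.
Qed.
Fact quotient_mulrV : right_inverse quotient_one quotient_inv quotient_mul.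
Proof.
by move=> x; elim/quotW: x => x; rewrite quotient_invE quotient_mulE mulgV.
Qed.

HB.instance Definition _ := isGroup.Build quotient_group
  quotient_mulA quotient_mul1 quotient_mulr1 quotient_mulV quotient_mulrV.

Definition quotient_pi (x : G) : quotient_group := \pi_quotient_group x.

Fact quotient_piM : {morph quotient_pi : x y / x * y}.
Proof. by move=> x y; rewrite [RHS]quotient_mulE. Qed.
Fact quotient_pi1 : quotient_pi 1 = 1. Proof. by []. Qed.

HB.instance Definition _ :=
  isMultiplicative.Build G quotient_group quotient_pi quotient_piM.
HB.instance Definition _ :=
  Multiplicative_isUMagmaMorphism.Build G quotient_group
    quotient_pi quotient_pi1.

Lemma ker_quotient_pi x : quotient_pi x = 1 <-> N x.
Proof.
rewrite /quotient_pi -[1]/(\pi_quotient_group 1).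
rewrite (rwP (@eqP quotient_group _ _)) eq_sym -(rwP (@eqP quotient_group _ _)).
by rewrite quotient_piP invg1 mul1g.
Qed.

End Quotient.

(** * Words in free generators and normal closures *)

Section FreeGroupMorphisms.
Implicit Types (X : choiceType) (G H : groupType).

Lemma free_ind X (P : free_group X -> Prop) :
  P 1 -> (forall x f, P f -> P (free_gen x * f)) ->
  (forall x f, P f -> P ((free_gen x)^-1 * f)) -> forall f, P f.
Proof.
move=> P1 PM PV f; elim/quotW: f => w.
elim: w => [//|[x e] w Pw].
rewrite -cat1s -free_mulE; case: e; first exact: PM.
by have := PV x _ Pw; rewrite [(free_gen x)^-1]free_invE.
Qed.

Lemma normal_closure_normal G (S : set G) :
  is_normal_subgroup (normal_closure S).
Proof.
split; [split|].
- by move=> H [[[]]].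
- move=> x y Sx Sy H HS; have [[[_ HM _] _] _] := HS.
  by apply: HM; [exact: Sx|exact: Sy].
- by move=> x Sx H HS; have [[[_ _ HV] _] _] := HS; apply: HV; exact: Sx.
- by move=> x y Sx H HS; have [[_ HJ] _] := HS; apply: HJ; exact: Sx.
Qed.

Lemma generated_subgroup G (S : set G) : is_subgroup (generated S).
Proof.
split.
- by move=> H [[]].
- move=> x y Sx Sy H HS; have [[_ HM _] _] := HS.
  by apply: HM; [exact: Sx|exact: Sy].
- by move=> x Sx H HS; have [[_ _ HV] _] := HS; apply: HV; exact: Sx.
Qed.

Lemma ker_normal G H (f : UMagmaMorphism.type G H) :
  is_normal_subgroup [set x | f x = 1].
Proof.
split; [split|]; rewrite /=.
- exact: gmulf1.
- by move=> x y; rewrite gmulfM => -> ->; rewrite mulg1.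
- by move=> x; rewrite gmulfV => ->; rewrite invg1.
- by move=> x y; rewrite !gmulfM gmulfV => ->; rewrite mulg1 mulgV.
Qed.

Lemma range_free_lift X G (g : X -> G) :
  range (free_lift g) = generated (range g).
Proof.
have [G1 GM GV] := generated_subgroup (range g).
have Gg x : generated (range g) (g x) by move=> H [_]; apply; exists x.
apply/seteqP; split => [_ [f _ <-]|].
  elim/free_ind: f => [|x f IH|x f IH]; first by rewrite gmulf1.
  - by rewrite free_liftM free_lift_gen; exact: GM.
  - by rewrite free_liftM gmulfV /= free_lift_gen; apply: GM => //; exact: GV.
apply: smallest_sub => [|_ [x _ <-]]; last first.
  by exists (free_gen x); rewrite ?free_lift_gen.
split.
- by exists 1; rewrite ?gmulf1.
- by move=> _ _ [x _ <-] [y _ <-]; exists (x * y); rewrite ?gmulfM.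
- by move=> _ [x _ <-]; exists x^-1; rewrite ?gmulfV.
Qed.

(** How normal forms identify a kernel: if every element is congruent, modulo
    the relators S, to a normal form in W, and f sends no nontrivial normal form
    to 1, then an element of the kernel is congruent to the normal form 1. *)
Lemma ker_normal_closure G H (f : UMagmaMorphism.type G H) (S W : set G) :
  (forall s, S s -> f s = 1) ->
  (forall x, exists2 w, W w &
     quotient_pi (normal_closure_normal S) x =
     quotient_pi (normal_closure_normal S) w) ->
  (forall w, W w -> f w = 1 -> w = 1) ->
  [set x | f x = 1] = normal_closure S.
Proof.
move=> fS red inj.
have SK : normal_closure S `<=` [set x | f x = 1].
  by apply: smallest_sub => //; exact: ker_normal.
apply/seteqP; split => // x fx.
have [w Ww xw] := red x.
have : normal_closure S (x^-1 * w).
  exact: (quotient_piP (normal_closure_normal S) x w).1 xw.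
move=> /SK /=; rewrite gmulfM gmulfV fx invg1 mul1g => /(inj _ Ww) w1.
by apply/(ker_quotient_pi (normal_closure_normal S)); rewrite xw w1 gmulf1.
Qed.

End FreeGroupMorphisms.

(** * Normal forms in a group that satisfies the relations *)

Section NormalForm.
Variables (G : groupType) (r1 r2 r3 t : G).

(** In the stabiliser, r2 r1 and r3 r1 are the translations by 2 and by
    i sqrt 2, and r1 is the rotation that inverts both. *)
Definition normal_form (e : bool) (m n k : int) : G :=
  zpow (r2 * r1) m * zpow (r3 * r1) n * zpow t k * r1 ^+ e.

Hypotheses (r1K : r1 ^+ 2 = 1) (r2K : r2 ^+ 2 = 1) (r3K : r3 ^+ 2 = 1).
Hypotheses (tr1 : comm t r1 = 1) (tr2 : comm t r2 = 1) (tr3 : comm t r3 = 1).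
Hypothesis rel : (t ^+ 2 * r1 * r3 * r2) ^+ 2 = 1.

Let a := r2 * r1.
Let b := r3 * r1.

Let commute_comm x : comm t x = 1 -> commute t x.
Proof. by move=> tx; apply/divg1_eq; rewrite invgM mulgA. Qed.

Let Vr (r : G) : r ^+ 2 = 1 -> r^-1 = r.
Proof. exact: mulg1_eq. Qed.

Let ta : commute t a.
Proof. by apply: commuteM; exact: commute_comm. Qed.

Let tb : commute t b.
Proof. by apply: commuteM; exact: commute_comm. Qed.

Let r1_invert (r : G) : r ^+ 2 = 1 -> r1 * (r * r1) = (r * r1)^-1 * r1.
Proof. by move=> rK; rewrite invgM !Vr // mulgA. Qed.

(** As t is central, the last relator is t ^ 4 (r1 r3 r2) ^ 2; moreover
    r1 r3 r2 r1 = b^-1 a and r3 r2 = b a^-1. *)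
Lemma mul_ba : b * a = a * b * t ^+ 4.
Proof.
have tu : commute (t ^+ 2) (r1 * r3 * r2).
  apply: commute_sym; apply: commuteX; apply: commute_sym.
  by apply: commuteM; first apply: commuteM; exact: commute_comm.
have u2 : (r1 * r3 * r2) ^+ 2 = b^-1 * a * (b * a^-1).
  rewrite expg2 /a /b !invgM !Vr // -!mulgA; do 4!congr (_ * _).
  by rewrite [r1 * (r1 * _)]mulgA -expg2 r1K mul1g.
have := rel; rewrite -!(mulgA (t ^+ 2)) (expgMn _ tu) u2 -expgnA.
move=> /mulg1_eq t4.
have a_t4 : commute a (t ^- 4).
  exact/commuteV/commuteX/commute_sym/ta.
apply: (mulIg (t ^- 4)); rewrite mulgK -mulgA a_t4 t4.
by rewrite -(mulgA (b^-1 * a)) mulgVK -(mulgA b^-1) mulVKg.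
Qed.

Lemma normal_form1 : normal_form false 0 0 0 = 1.
Proof. by rewrite /normal_form !mulg1. Qed.

Lemma normal_form_mulr1 e m n k :
  r1 * normal_form e m n k = normal_form (~~ e) (- m)%R (- n)%R k.
Proof.
rewrite /normal_form -!zpowVn !mulgA.
rewrite (zpow_intertwine m (r1_invert r2K)) -!mulgA; congr (_ * _).
rewrite !mulgA (zpow_intertwine n (r1_invert r3K)) -!mulgA; congr (_ * _).
have /esym/(commute_zpow k) r1t := commute_comm tr1.
rewrite mulgA r1t -mulgA; congr (_ * _).
by case: e; rewrite ?mulg1 // -expg2 r1K.
Qed.

Lemma normal_form_mula e m n k :
  a * normal_form e m n k = normal_form e (m + 1)%R n k.
Proof. by rewrite /normal_form zpowS !mulgA. Qed.

(** The exponent of t grows by 4 m, since b has to pass a ^ m. *)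
Lemma normal_form_mulb e m n k :
  b * normal_form e m n k = normal_form e m (n + 1)%R (k + 4 * m)%R.
Proof.
have t4a : commute a (t ^+ 4) by exact: commuteX _ (commute_sym ta).
have t4b : commute b (t ^+ 4) by exact: commuteX _ (commute_sym tb).
have ba : b * a = a * t ^+ 4 * b.
  by rewrite mul_ba -(mulgA a) -(mulgA a (t ^+ 4)) t4b.
rewrite /normal_form !mulgA -(mulgA b) (zpow_shuffle _ _ t4a t4b ba).
rewrite (addrC k) (zpowD t) (zpowM t 4) -!(mulgA (_ * zpow b _)).
by rewrite !mulgA.
Qed.

Lemma normal_form_mult e m n k :
  t * normal_form e m n k = normal_form e m n (k + 1)%R.
Proof.
rewrite /normal_form zpowS !mulgA; congr (_ * _ * _).
rewrite (commute_zpow m ta) -!mulgA; congr (_ * _).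
exact: commute_zpow.
Qed.

(** Left multiplication by r1, a, b and t has been computed above; it yields the
    other letters because r2 = a r1 and r3 = b r1. *)
Lemma normal_form_mul_closed r :
  [set r1; r2; r3; t; t^-1] r ->
  forall x, (exists e m n k, x = normal_form e m n k) ->
  exists e m n k, r * x = normal_form e m n k.
Proof.
have mul_r1K r' : r' = r' * r1 * r1 by rewrite -mulgA -expg2 r1K mulg1.
move=> rr x [e [m [n [k ->]]]]; case: rr => [[[[->|->]|->]|->]|->].
- by do 4!eexists; exact: normal_form_mulr1.
- rewrite [r2]mul_r1K -mulgA normal_form_mulr1 normal_form_mula.
  by do 4!eexists.
- rewrite [r3]mul_r1K -mulgA normal_form_mulr1 normal_form_mulb.
  by do 4!eexists.
- by do 4!eexists; exact: normal_form_mult.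
- exists e, m, n, (k - 1)%R; apply: (mulgI t).
  by rewrite mulVKg normal_form_mult subrK.
Qed.

End NormalForm.

Lemma gmulf_normal_form (G H : groupType) (f : UMagmaMorphism.type G H)
    (r1 r2 r3 t : G) e m n k :
  f (normal_form r1 r2 r3 t e m n k) =
  normal_form (f r1) (f r2) (f r3) (f t) e m n k.
Proof. by rewrite /normal_form !(gmulfM, gmulf_zpow, gmulfXn). Qed.

(** * The ring of the integers p + q i sqrt 2 *)

Section Quadratic.
Local Open Scope ring_scope.
Variable R : realType.
Local Notation C := R[i].
Local Notation s := (isqrt2 R).

Definition qint (p q : int) : C := p%:~R + q%:~R * s.

Lemma qintM p q p' q' :
  qint p q * qint p' q' = qint (p * p' - 2 * (q * q')) (p * q' + q * p').
Proof.
rewrite /qint !rmorphD !rmorphN !rmorphM /=.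
by have := sqr_isqrt2 R; move: (isqrt2 R) => x x2; ring: x2.
Qed.

Lemma conj_qint p q : (qint p q)^* = qint p (- q).
Proof.
rewrite /qint rmorphD rmorphM /= conj_isqrt2 !rmorph_int.
by rewrite mulrN mulrNz mulNr.
Qed.

Lemma qint_inj p q p' q' : qint p q = qint p' q' -> p = p' /\ q = q'.
Proof.
have s0 : Num.sqrt 2 != 0 :> R by rewrite sqrtr_eq0 -ltNge ltr0n.
have E u v : qint u v = (u%:~R +i* (v%:~R * Num.sqrt 2))%C.
  rewrite /qint /isqrt2 -!(rmorph_int (real_complex R)) /=.
  by rewrite /real_complex_def; simpc.
rewrite !E => -[/eqP + /eqP].
by rewrite (inj_eq (mulIf s0)) !eqr_int => /eqP-> /eqP->.
Qed.

Lemma O2P z : O2 R z <-> exists p q, z = qint p q.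
Proof.
split=> [[P ->]|[p [q ->]]]; last first.
  exists (p%:P + q%:P * 'X).
  by rewrite rmorphD rmorphM /= !map_polyC map_polyX !hornerE /qint.
elim/poly_ind: P => [|P c [p [q IH]]].
  by exists 0, 0; rewrite rmorph0 horner0 /qint mul0r addr0.
exists (c - 2 * q), p.
rewrite rmorphD rmorphM /= map_polyC map_polyX !hornerE IH /qint.
rewrite !rmorphD !rmorphN !rmorphM /=.
by have := sqr_isqrt2 R; move: (isqrt2 R) => x x2; ring: x2.
Qed.

(** The norm p ^ 2 + 2 q ^ 2 is multiplicative, and it is 1 only at 1 and -1. *)
Lemma qint_unit p q p' q' : qint p q * qint p' q' = 1 ->
  (p = 1 \/ p = -1) /\ q = 0.
Proof.
have q1 : (1 : C) = qint 1 0 by rewrite /qint; ring.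
rewrite qintM q1 => /qint_inj[e1 e2].
have : (p ^+ 2 + 2 * q ^+ 2) * (p' ^+ 2 + 2 * q' ^+ 2) = 1.
  transitivity ((p * p' - 2 * (q * q')) ^+ 2 + 2 * (p * q' + q * p') ^+ 2).
    by ring.
  by rewrite e1 e2.
have unit1 (u v : int) : 0 <= u -> 0 <= v -> u * v = 1 -> u = 1.
  move=> u0 v0 uv; have [v1|v1] : v = 0 \/ 1 <= v by lia.
  - by nia.
  - by nia.
move=> /unit1 n1; have {}n1 : p ^+ 2 + 2 * q ^+ 2 = 1 by apply: n1; nia.
have q0 : q = 0 by nia.
by split => //; move: n1; rewrite q0; nia.
Qed.

Lemma qint_sign (b : bool) p q :
  qint ((-1) ^+ b * p) ((-1) ^+ b * q) = (-1) ^+ b * qint p q.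
Proof. by rewrite /qint !rmorphM !rmorph_sign; ring. Qed.

Lemma qint_unit_sign p q p' q' : qint p q * qint p' q' = 1 ->
  exists b : bool, qint p q = (-1) ^+ b.
Proof.
case/qint_unit => -[->|->] ->; [exists false|exists true]; rewrite /qint; ring.
Qed.

End Quadratic.

(** * The matrices of the stabiliser *)

Section Heis.
Local Open Scope ring_scope.
Local Open Scope quotient_scope.
Variable R : realType.
Local Notation C := R[i].

(** The composite of the Heisenberg translation that sends [0, 0, 1] to
    [c, e, 1], for e = 2 m + n i sqrt 2, with the complex reflection
    diag(1, (-1) ^ d, 1). *)
Definition heis_mx (d : bool) (m n k : int) : 'M[C]_3 :=
  mx3 [:: [:: 1; - (-1) ^+ d * qint R (2 * m) (- n);
              qint R (- (2 * m ^+ 2 + n ^+ 2)) k]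
        ; [:: 0; (-1) ^+ d; qint R (2 * m) n]
        ; [:: 0; 0; 1]].

Lemma heis_U21 d m n k : preserves_form (heis_mx d m n k).
Proof.
apply/preserves_formP => z w; rewrite /herm !mx3_mulE /=.
rewrite /qint !(rmorph_int, rmorphD, rmorphM, rmorphN, rmorph0, rmorph1).
rewrite !(rmorphXn, rmorph_sign) /=.
rewrite conj_isqrt2; have := sqr_isqrt2 R; move: (isqrt2 R) => x x2.
by case: d; rewrite ?expr1 ?expr0; ring: x2.
Qed.

Definition heis d m n k : U21 R := MkU21 (heis_U21 d m n k).

(** The last coordinate picks up the coefficient of i sqrt 2 in - d conj(e) e',
    the symplectic form that defines a Heisenberg group. *)
Lemma heisM (d : bool) m n k (d' : bool) m' n' k' :
  let sg : int := (-1) ^+ d in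
  (heis d m n k * heis d' m' n' k')%g =
  heis (d (+) d') (m + sg * m') (n + sg * n')
    (k + k' - 2 * sg * (m * n' - n * m')).
Proof.
move=> sg; apply: val_inj => /=; apply/matrixP => i j; rewrite !mxE.
rewrite !big_ord_recl big_ord0 addr0 !mxE /=.
have := sqr_isqrt2 R; rewrite /qint; move: (isqrt2 R) => x x2.
rewrite {}/sg; move: i j; apply: ord3P; apply: ord3P => /=.
all: rewrite ?(rmorphD, rmorphN, rmorphM, rmorphXn, rmorph_sign) /=.
all: case: d; case: d'; rewrite /= ?expr1 ?expr0; ring: x2.
Qed.

Lemma R1_heis : MkU21 (R1_U21 R) = heis true 0 0 0.
Proof.
apply: val_inj; apply/matrixP; apply: ord3P; apply: ord3P.
all: by rewrite !mxE /= /qint; ring.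
Qed.

Lemma R2_heis : MkU21 (R2_U21 R) = heis true 1 0 0.
Proof.
apply: val_inj; apply/matrixP; apply: ord3P; apply: ord3P.
all: by rewrite !mxE /= /qint; ring.
Qed.

Lemma R3_heis : MkU21 (R3_U21 R) = heis true 0 1 0.
Proof.
apply: val_inj; apply/matrixP; apply: ord3P; apply: ord3P.
all: by rewrite !mxE /= /qint; ring.
Qed.

Lemma T_heis : MkU21 (T_U21 R) = heis false 0 0 1.
Proof.
apply: val_inj; apply/matrixP; apply: ord3P; apply: ord3P.
all: by rewrite !mxE /= /qint; ring.
Qed.

Lemma heis1 : heis false 0 0 0 = 1%g.
Proof.
apply: val_inj; apply/matrixP; apply: ord3P; apply: ord3P.
all: by rewrite !mxE /= /qint; ring.
Qed.

(** A scalar matrix with first entry 1 is the identity, so passing to PU(2,1)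
    loses nothing on these matrices. *)
Lemma pi_heis_eq1 d m n k : \pi_(PU21 R) (heis d m n k) = 1%g ->
  [/\ d = false, m = 0, n = 0 & k = 0].
Proof.
move=> /esym/PU_piP[th]; rewrite -heis1 => /matrixP e.
have th1 : expi th = 1.
  by have := e 0 0; rewrite !mxE /= mulr1 => <-.
have := e 1 1; rewrite !mxE /= th1 mul1r.
rewrite -{2}(expr0 (-1 : C)) => /(@signr_inj C d false) ->.
have := e 1 2; rewrite !mxE /= th1 mul1r => /qint_inj[m0 ->].
have := e 0 2; rewrite !mxE /= th1 mul1r => /qint_inj[_ ->].
by split => //; lia.
Qed.

Lemma heis_Gamma2_inf d m n k : Gamma2_inf R (\pi_(PU21 R) (heis d m n k)).
Proof.
split.
  exists (heis d m n k) => //.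
  apply: ord3P; apply: ord3P; rewrite mxE /=; apply/O2P.
  - by exists 1, 0; rewrite /qint; ring.
  - exists (- (-1) ^+ d * (2 * m)), ((-1) ^+ d * n).
    by rewrite /qint !(rmorphM, rmorphN, rmorph_sign) /=; ring.
  - by do 2!eexists.
  - by exists 0, 0; rewrite /qint; ring.
  - by exists ((-1) ^+ d), 0; rewrite /qint rmorph_sign; ring.
  - by do 2!eexists.
  - by exists 0, 0; rewrite /qint; ring.
  - by exists 0, 0; rewrite /qint; ring.
  - by exists 1, 0; rewrite /qint; ring.
rewrite PU21_act_pi; apply: val_inj => /=; rewrite limg_line lfunE /=.
congr <[_]>%VS; apply/matrixP => i j; rewrite (ord1 j) mx3_mulE !mxE /=.
by move: i; apply: ord3P; rewrite /= ?mulr0 ?mulr1 ?addr0 ?mul0r.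
Qed.

Lemma expi_sign (b : bool) : exists th : R, expi th = (-1) ^+ b.
Proof.
case: b; last by exists 0; rewrite expi0.
exists pi; rewrite /expi cospi sinpi.
by apply/eqP; rewrite eq_complex /= oppr0 !eqxx.
Qed.

(** The matrix is triangular because it fixes [q_inf]; the other constraints are
    the Hermitian products of its columns.  The last column has norm 0, that is
    2 Re c = - |e|^2, and this forces the rational part of e to be even. *)
Lemma Gamma2_inf_heis g : Gamma2_inf R g ->
  exists d m n k, g = \pi_(PU21 R) (heis d m n k).
Proof.
case=> -[a Oa ->]; rewrite PU21_act_pi => /(congr1 (@line R)) /= aq.
have /vlineP[l al] : a *m delta_mx 0 0 \in <[delta_mx 0%R 0%R : 'cV[C]_3]>%VS.
  rewrite -aq -[a *m _]/(mulmx a _) -(lfunE (mulmx a)).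
  exact/memv_img/memv_line.
have a0 i : i != 0 -> U21_mx a i 0 = 0.
  move=> /negPf i0; move/matrixP/(_ i 0): al.
  by rewrite -colE !mxE i0 mulr0.
have H i j : herm (col i (U21_mx a)) (col j (U21_mx a)) =
    herm (delta_mx i 0) (delta_mx j 0).
  by rewrite !colE (preserves_formP _ (U21_mxP a)).
have := (H 0 1, H 0 2, H 1 1, H 1 2, H 2 2); rewrite /herm !mxE /=.
rewrite !(a0 1, a0 2) // !(conjC0, conjC1) !(mul0r, mulr0, addr0, add0r, mul1r).
case=> -[[[E01 E02] E11] E12] E22.
have {Oa} O i j : exists p q, U21_mx a i j = qint R p q by exact/O2P.
have [p00 [q00 e00]] := O 0 0.
have [p11 [q11 e11]] := O 1 1.
have [p22 [q22 e22]] := O 2 2.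
have [u [v e12]] := O 1 2.
have [x [y e02]] := O 0 2.
have [sg sgE] : exists sg : bool, U21_mx a 0 0 = (-1) ^+ sg.
  by move: E02; rewrite e00 e22 conj_qint; exact: qint_unit_sign.
have sgK : (-1) ^+ sg * (-1) ^+ sg = 1 :> C by rewrite -signr_addb addbb.
have divsg w c : U21_mx a 0 0 * w = c -> w = (-1) ^+ sg * c.
  by move=> <-; rewrite sgE mulrA sgK mul1r.
have a22 : U21_mx a 2 2 = (-1) ^+ sg.
  by rewrite -[LHS]conjCK (divsg _ _ E02) mulr1 rmorph_sign.
have a21 : U21_mx a 2 1 = 0.
  by rewrite -[LHS]conjCK (divsg _ _ E01) mulr0 conjC0.
move: E11 E12 E22; rewrite a21 a22 conjC0 rmorph_sign.
rewrite !(mul0r, mulr0, addr0, add0r) => E11 E12 E22.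
have [dl dlE] : exists dl : bool, U21_mx a 1 1 = (-1) ^+ dl.
  by move: E11; rewrite e11 conj_qint; exact: qint_unit_sign.
have a01 : U21_mx a 0 1 = - (-1) ^+ (sg (+) dl) * (U21_mx a 1 2)^*.
  move/(congr1 ( *%R^~ ((-1) ^+ sg))): E12.
  rewrite mul0r mulrDl -mulrA sgK mulr1 dlE => /eqP.
  rewrite addr_eq0 => /eqP ->.
  by rewrite signr_addb; ring.
have : qint R (2 * ((-1) ^+ sg * x) + (u ^+ 2 + 2 * v ^+ 2)) 0 = qint R 0 0.
  transitivity (0 : C); last by rewrite /qint; ring.
  rewrite -E22 e02 e12 !conj_qint qintM /qint.
  by rewrite !(rmorphD, rmorphN, rmorphM, rmorphXn, rmorph_sign) /=; ring.
case/qint_inj => norm_e _.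
have [u2 uE] : exists u2, u = 2 * u2.
  have [u2 [uE|uE]] : exists u2, u = 2 * u2 \/ u = 2 * u2 + 1.
  - by exists (divz u 2); lia.
  - by exists u2.
  - by exfalso; move: norm_e; rewrite uE; move: ((-1) ^+ sg * x) => z; lia.
have xE : (-1) ^+ sg * x = - (2 * u2 ^+ 2 + v ^+ 2).
  by move: norm_e; rewrite uE; move: ((-1) ^+ sg * x) => z; lia.
(* Division by the first entry, the sign sg, makes the first entry 1. *)
exists (sg (+) dl), ((-1) ^+ sg * u2), ((-1) ^+ sg * v), ((-1) ^+ sg * y).
have [th thE] := expi_sign sg.
apply/PU_piP; exists th; rewrite thE; apply/matrixP.
have sgM z : ((-1) ^+ sg * z) ^+ 2 = z ^+ 2 :> int.
  by rewrite exprMn sqrr_sign mul1r.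
have eE : (-1) ^+ sg * U21_mx a 1 2 =
    qint R (2 * ((-1) ^+ sg * u2)) ((-1) ^+ sg * v).
  by rewrite e12 uE -qint_sign; congr qint; ring.
apply: ord3P; apply: ord3P; rewrite !mxE /=.
- by rewrite sgE sgK.
- rewrite a01 signr_addb -[qint _ _ _]conjCK conj_qint opprK -eE.
  by rewrite rmorphM rmorph_sign; ring.
- by rewrite e02 -qint_sign xE !sgM.
- by rewrite a0 // mulr0.
- by rewrite dlE signr_addb.
- by rewrite eE.
- by rewrite a0 // mulr0.
- by rewrite a21 mulr0.
- by rewrite a22 sgK.
Qed.

End Heis.

(** * The presentation *)

Lemma commute_comm1 (G : groupType) (x y : G) : commute x y -> comm x y = 1.
Proof. by rewrite /comm => ->; rewrite mulgK mulgV. Qed.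

Lemma gmulf_comm (G H : groupType) (f : UMagmaMorphism.type G H) x y :
  f (comm x y) = comm (f x) (f y).
Proof. by rewrite /comm !gmulfM !gmulfV. Qed.

Lemma ord4P (P : 'I_4 -> Prop) :
  P 0%R -> P 1%R -> P 2%R -> P 3%R -> forall i, P i.
Proof.
move=> P0 P1 P2 P3 [[|[|[|[|//]]]] lti].
- by rewrite (_ : Ordinal lti = 0%R) //; exact: val_inj.
- by rewrite (_ : Ordinal lti = 1%R) //; exact: val_inj.
- by rewrite (_ : Ordinal lti = 2%R) //; exact: val_inj.
- by rewrite (_ : Ordinal lti = 3%R) //; exact: val_inj.
Qed.

Definition word_normal_form : bool -> int -> int -> int -> free_group 'I_4 :=
  normal_form (free_gen 0%R) (free_gen 1%R) (free_gen 2%R) (free_gen 3%R).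

Lemma forall_rels (P : free_group 'I_4 -> Prop) :
  (forall s, Gamma2_inf_rels s -> P s) <->
  [/\ P (free_gen 0%R ^+ 2), P (free_gen 1%R ^+ 2) & P (free_gen 2%R ^+ 2)] /\
  [/\ P (comm (free_gen 3%R) (free_gen 0%R)),
     P (comm (free_gen 3%R) (free_gen 1%R)),
     P (comm (free_gen 3%R) (free_gen 2%R)) &
     P ((free_gen 3%R ^+ 2 * free_gen 0%R * free_gen 2%R * free_gen 1%R) ^+ 2)].
Proof.
split => [Ps|[[? ? ?] [? ? ? ?]] s].
  split; split; apply: Ps; rewrite /Gamma2_inf_rels /=.
  - by left; left; exists (free_gen 0%R) => //; left; left.
  - by left; left; exists (free_gen 1%R) => //; left; right.
  - by left; left; exists (free_gen 2%R) => //; right.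
  - by left; right; exists (free_gen 0%R) => //; left; left.
  - by left; right; exists (free_gen 1%R) => //; left; right.
  - by left; right; exists (free_gen 2%R) => //; right.
  - by right.
by case=> [[[r + <-]|[r + <-]]|->] //; case=> [[|]|] ->.
Qed.

(** Used for the map to [PU21] and for the quotient by the normal closure of the
    relators. *)
Lemma morph_word_normal_form (G : groupType)
    (h : UMagmaMorphism.type (free_group 'I_4) G) :
  (forall s, Gamma2_inf_rels s -> h s = 1) ->
  forall f, exists e m n k, h f = h (word_normal_form e m n k).
Proof.
move=> /forall_rels[[]].
rewrite !gmulf_comm !(gmulfXn, gmulfM) /=.
set r1 := h _; set r2 := h _; set r3 := h _ => r1K r2K r3K [].
set t := h _ => tr1 tr2 tr3 rel f.
suff [e [m [n [k hf]]]] : exists e m n k, h f = normal_form r1 r2 r3 t e m n k.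
  by exists e, m, n, k; rewrite gmulf_normal_form.
have closed := normal_form_mul_closed r1K r2K r3K tr1 tr2 tr3 rel.
have Vr (r : G) : r ^+ 2 = 1 -> r^-1 = r by exact: mulg1_eq.
elim/free_ind: f => [|x f IH|x f IH].
- by rewrite gmulf1; exists false, 0%R, 0%R, 0%R; rewrite normal_form1.
- rewrite gmulfM; apply: closed => //.
  move: x; apply: ord4P; rewrite -?/r1 -?/r2 -?/r3 -?/t /=; tauto.
- rewrite gmulfM gmulfV; apply: closed => //.
  move: x; apply: ord4P; rewrite -?/r1 -?/r2 -?/r3 -?/t /=.
  all: rewrite ?(Vr _ r1K) ?(Vr _ r2K) ?(Vr _ r3K); tauto.
Qed.

Section Presentation.
Variable R : realType.
Local Notation gen := (Gamma2_inf_gen R).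
Local Notation r1 := (MkU21 (R1_U21 R)).
Local Notation r2 := (MkU21 (R2_U21 R)).
Local Notation r3 := (MkU21 (R3_U21 R)).
Local Notation t := (MkU21 (T_U21 R)).

Definition PU_pi (u : U21 R) : PU21 R := \pi_(PU21 R)%qT u.

Fact PU_pi_mul : {morph PU_pi : x y / x * y}.
Proof. exact: PU_piM. Qed.
Fact PU_pi_one : PU_pi 1 = 1.
Proof. by []. Qed.

HB.instance Definition _ :=
  isMultiplicative.Build (U21 R) (PU21 R) PU_pi PU_pi_mul.
HB.instance Definition _ :=
  Multiplicative_isUMagmaMorphism.Build (U21 R) (PU21 R) PU_pi PU_pi_one.

(** The shift by 2 m n comes from [heisM], in the product of (r2 r1) ^ m by
    (r3 r1) ^ n. *)
Lemma normal_form_heis e m n k :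
  normal_form r1 r2 r3 t e m n k = heis R e m n (k - 2 * (m * n))%R.
Proof.
rewrite /normal_form R1_heis R2_heis R3_heis T_heis !heisM.
rewrite -(zpow_unique (f := fun m => heis R false m 0 0)); first last.
- by move=> i; rewrite heisM /=; congr heis; rewrite ?expr1 ?expr0; ring.
- by rewrite heis1.
rewrite -(zpow_unique (f := fun m => heis R false 0 m 0)); first last.
- by move=> i; rewrite heisM /=; congr heis; rewrite ?expr1 ?expr0; ring.
- by rewrite heis1.
rewrite -(zpow_unique (f := fun m => heis R false 0 0 m)); first last.
- by move=> i; rewrite heisM /=; congr heis; rewrite ?expr1 ?expr0; ring.
- by rewrite heis1.
have -> : heis R true 0 0 0 ^+ e = heis R e 0 0 0.
  by case: e; rewrite ?heis1.
by rewrite !heisM /=; congr heis; rewrite ?expr1 ?expr0; ring.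
Qed.

Lemma gen_lift : [/\ free_lift gen (free_gen 0%R) = PU_pi r1,
  free_lift gen (free_gen 1%R) = PU_pi r2,
  free_lift gen (free_gen 2%R) = PU_pi r3 &
  free_lift gen (free_gen 3%R) = PU_pi t].
Proof. by split; rewrite free_lift_gen /Gamma2_inf_gen (tnth_nth 1). Qed.

Lemma lift_word_normal_form e m n k :
  free_lift gen (word_normal_form e m n k) =
  PU_pi (heis R e m n (k - 2 * (m * n))%R).
Proof.
have [g0 g1 g2 g3] := gen_lift.
by rewrite gmulf_normal_form /= g0 g1 g2 g3 -gmulf_normal_form normal_form_heis.
Qed.

Lemma lift_rels s : Gamma2_inf_rels s -> free_lift gen s = 1.
Proof.
have [g0 g1 g2 g3] := gen_lift.
move: s; apply/forall_rels; rewrite !gmulf_comm !(gmulfXn, gmulfM) /=.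
rewrite g0 g1 g2 g3 -!gmulf_comm -!(gmulfXn, gmulfM).
have com x : commute t x -> PU_pi (comm t x) = 1.
  by move=> /commute_comm1 ->.
have K x : x = 1 -> PU_pi x = 1 by move=> ->.
split; split; [apply: K..|apply: com|apply: com|apply: com|apply: K].
all: rewrite /commute ?expg2 ?expg2 !(R1_heis, R2_heis, R3_heis, T_heis).
all: rewrite !heisM /= -?heis1.
all: congr heis; rewrite /= ?expr1 ?expr0; ring.
Qed.

Lemma range_gen : range gen = [set R1 R; R2 R; R3 R; T R].
Proof.
have E (i : 'I_4) : gen i = nth 1 [:: R1 R; R2 R; R3 R; T R] i.
  by rewrite /Gamma2_inf_gen (tnth_nth 1).
apply/seteqP; split => [_ [i _ <-]|x].
  by move: i; apply: ord4P; rewrite E /=; tauto.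
by case=> [[[|]|]|] ->; [exists 0%R|exists 1%R|exists 2%R|exists 3%R].
Qed.

Lemma range_lift : range (free_lift gen) = Gamma2_inf R.
Proof.
apply/seteqP; split => [_ [f _ <-]|x].
  have [e [m [n [k ->]]]] := morph_word_normal_form lift_rels f.
  rewrite [X in Gamma2_inf R X]lift_word_normal_form; exact: heis_Gamma2_inf.
case/Gamma2_inf_heis => e [m [n [k ->]]].
exists (word_normal_form e m n (k + 2 * (m * n))%R) => //.
by rewrite lift_word_normal_form addrK.
Qed.

Lemma ker_lift :
  [set f | free_lift gen f = 1] = normal_closure Gamma2_inf_rels.
Proof.
pose W := [set w | exists e m n k, w = word_normal_form e m n k].
apply: (ker_normal_closure (W := W)).
- exact: lift_rels.
- move=> x; have [|e [m [n [k E]]]] := @morph_word_normal_form _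
    (quotient_pi (normal_closure_normal Gamma2_inf_rels)) _ x.
    by move=> s ss; apply/ker_quotient_pi => H [_]; apply.
  by exists (word_normal_form e m n k) => //; exists e, m, n, k.
- move=> _ [e [m [n [k ->]]]] /=; rewrite lift_word_normal_form.
  case/pi_heis_eq1 => -> -> -> kE; rewrite (_ : k = 0%R); last by lia.
  exact: normal_form1.
Qed.

End Presentation.

Theorem proposition3p2 (R : realType) :
  Gamma2_inf R = generated [set R1 R; R2 R; R3 R; T R] /\
  has_presentation (Gamma2_inf R) (Gamma2_inf_gen R) Gamma2_inf_rels.
Proof.
split; first by rewrite -range_gen -range_free_lift range_lift.
by split; [exact: range_lift|exact: ker_lift].
Qed.
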